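(* Let $p$ be a prime, let $A=\{\mathbf a_1,\dots,\mathbf a_N\}\subseteq\mathbb Z^n$ with $\mathbf a_j=(a_{j1},\dots,a_{jn})$, and let $\beta=(\beta_1,\dots,\beta_n)\in\mathbb Z^n$. Let $T_A(\beta)\subseteq\mathbb F_p((\lambda_1,\dots,\lambda_N))$ be the set of all $G$ annihilated by the operators $$\Box_l=\prod_{l_i>0}\Big(\frac{\partial}{\partial\lambda_i}\Big)^{l_i}-\prod_{l_i<0}\Big(\frac{\partial}{\partial\lambda_i}\Big)^{-l_i}\quad (l\in L)$$ and by the operators $Z_i=\sum_{j=1}^N a_{ji}\lambda_j\frac{\partial}{\partial\lambda_j}-\beta_i$ for $i=1,\dots,n$ (all coefficients read in $\mathbb F_p$). Then $T_A(\beta)$ is a vector space over $\mathbb F_p((\lambda_1^p,\dots,\lambda_N^p))$ and the set of polynomials $\{G_\gamma : \gamma\in\tau_A(\beta)\}$ is a basis of $T_A(\beta)$ over $\mathbb F_p((\lambda_1^p,\dots,\lambda_N^p))$.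
   Context: $\mathbb F_p((\lambda_1,\dots,\lambda_N))$ denotes the fraction field of $\mathbb F_p[[\lambda_1,\dots,\lambda_N]]$. $L=\{l\in\mathbb Z^N:\sum_i l_i\mathbf a_i=\mathbf 0\}$ is the lattice of relations of $A$. $\mathbb N=\{0,1,\dots\}$ and $\mathbb NA=\{\sum_i c_i\mathbf a_i: c_i\in\mathbb N\}$. For $\gamma\in\mathbb NA$ let $U^+(\gamma)=\{u\in\mathbb N^N:\sum_i u_i\mathbf a_i=\gamma\}$. An element $\gamma\in\mathbb NA$ is very good if every $u\in U^+(\gamma)$ satisfies $u_i\le p-1$ for all $i$. For very good $\gamma$, $G_\gamma(\lambda)=\sum_{u\in U^+(\gamma)}\frac{\lambda_1^{u_1}\cdots\lambda_N^{u_N}}{u_1!\cdots u_N!}\in\mathbb F_p[\lambda_1,\dots,\lambda_N]$. Finally $\tau_A(\beta)=\{\gamma\in(\beta+p\mathbb Z^n)\cap\mathbb NA:\gamma\text{ very good}\}$. *)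

(* Defs.v *)
From HB Require Import structures.
From mathcomp Require Import all_boot all_order all_algebra.
From mathcomp Require Import generic_quotient fraction ring.
From mathcomp Require Import boolp classical_sets cardinality fsbigop.
From mathcomp Require Import mpoly.

Set Implicit Arguments.
Unset Strict Implicit.
Unset Printing Implicit Defensive.

Import GRing.Theory.
Local Open Scope ring_scope.
Local Open Scope quotient_scope.
Local Open Scope classical_set_scope.

Record mpseries (R : Type) (N : nat) :=
  MPSeries { pscoef :> 'X_{1..N} -> R }.

Notation "{ 'mpseries' R [ N ] }" := (mpseries R N)
  (at level 0, R, N at level 2, format "{ 'mpseries'  R [ N ] }") : type_scope.

Lemma mpseriesP (R : Type) (N : nat) (f g : {mpseries R[N]}) :
  f =1 g <-> f = g.
Proof.
split=> [|-> //]; case: f g => [f] [g] /= fg.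
by congr MPSeries; apply/funext.
Qed.

HB.instance Definition _ (R : Type) (N : nat) := gen_eqMixin {mpseries R[N]}.
HB.instance Definition _ (R : Type) (N : nat) :=
  gen_choiceMixin {mpseries R[N]}.

Section MPSeriesZmod.
Variables (R : zmodType) (N : nat).
Implicit Types f g h : {mpseries R[N]}.

Definition pszero : {mpseries R[N]} := MPSeries (fun=> 0).
Definition psopp f : {mpseries R[N]} := MPSeries (fun m => - f m).
Definition psadd f g : {mpseries R[N]} := MPSeries (fun m => f m + g m).

Lemma psaddA : associative psadd.
Proof. by move=> f g h; apply/mpseriesP => m /=; rewrite addrA. Qed.
Lemma psaddC : commutative psadd.
Proof. by move=> f g; apply/mpseriesP => m /=; rewrite addrC. Qed.
Lemma psadd0 : left_id pszero psadd.
Proof. by move=> f; apply/mpseriesP => m /=; rewrite add0r. Qed.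
Lemma psaddN : left_inverse pszero psopp psadd.
Proof. by move=> f; apply/mpseriesP => m /=; rewrite addNr. Qed.

HB.instance Definition _ :=
  GRing.isZmodule.Build {mpseries R[N]} psaddA psaddC psadd0 psaddN.

Lemma pscoef0 m : (0 : {mpseries R[N]}) m = 0. Proof. by []. Qed.
Lemma pscoefD f g m : (f + g) m = f m + g m. Proof. by []. Qed.
Lemma pscoefN f m : (- f) m = - f m. Proof. by []. Qed.
Lemma pscoefB f g m : (f - g) m = f m - g m. Proof. by []. Qed.

End MPSeriesZmod.

Section MPSeriesRing.
Variables (R : comNzRingType) (N : nat).
Implicit Types f g h : {mpseries R[N]}.

Definition psone : {mpseries R[N]} := MPSeries (fun m => (m == 0%MM)%:R).

Definition psmul f g : {mpseries R[N]} := MPSeries (fun m =>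
  \sum_(k : 'X_{1..N < (mdeg m).+1, (mdeg m).+1} | m == (k.1 + k.2)%MM)
    f k.1 * g k.2).

Definition pstrunc (d : nat) f : {mpoly R[N]} :=
  \sum_(k : 'X_{1..N < d}) f k *: 'X_[k].

Lemma mcoeff_pstrunc d f m : (mdeg m < d)%N -> (pstrunc d f)@_m = f m.
Proof. exact: mcoeff_mpoly. Qed.

Lemma psmulE d f g m :
  (mdeg m < d)%N -> psmul f g m = (pstrunc d f * pstrunc d g)@_m.
Proof.
move=> lt_md; rewrite mcoeffM; apply: eq_bigr => -[[k1 lt1] [k2 lt2]] /= /eqP mE.
by rewrite !mcoeff_pstrunc // (leq_trans _ lt_md).
Qed.

Lemma mcoeffM_eq (p q p' q' : {mpoly R[N]}) m :
    (forall k, (mdeg k <= mdeg m)%N -> p@_k = p'@_k) ->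
    (forall k, (mdeg k <= mdeg m)%N -> q@_k = q'@_k) ->
  (p * q)@_m = (p' * q')@_m.
Proof.
move=> pE qE; rewrite !mcoeffM; apply: eq_bigr => -[[k1 lt1] [k2 lt2]] /= /eqP mE.
by rewrite pE ?qE.
Qed.

Lemma psmulC : commutative psmul.
Proof.
move=> f g; apply/mpseriesP => m.
by rewrite !(@psmulE (mdeg m).+1) // mulrC.
Qed.

Lemma psmulA : associative psmul.
Proof.
move=> f g h; apply/mpseriesP => m; set d := (mdeg m).+1.
rewrite !(@psmulE d) //.
transitivity ((pstrunc d f * (pstrunc d g * pstrunc d h))@_m).
  apply: mcoeffM_eq => // k le_km.
  by rewrite mcoeff_pstrunc // (@psmulE d).
rewrite mulrA; apply: mcoeffM_eq => // k le_km.
by rewrite mcoeff_pstrunc // (@psmulE d).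
Qed.

Lemma psmul1 : left_id psone psmul.
Proof.
move=> f; apply/mpseriesP => m; rewrite (@psmulE (mdeg m).+1) //.
rewrite -[RHS](@mcoeff_pstrunc (mdeg m).+1) // -[in RHS](mul1r (pstrunc _ f)).
by apply: mcoeffM_eq => // k le_km; rewrite mcoeff_pstrunc // mcoeff1.
Qed.

Lemma psmulDl : left_distributive psmul +%R.
Proof.
move=> f g h; apply/mpseriesP => m /=.
by rewrite -big_split /=; apply: eq_bigr => k _; rewrite mulrDl.
Qed.

Lemma psone_neq0 : psone != 0.
Proof.
apply/eqP => /(congr1 (fun f => f 0%MM)) /=; rewrite eqxx => /eqP.
by rewrite oner_eq0.
Qed.

HB.instance Definition _ := GRing.Zmodule_isComNzRing.Build {mpseries R[N]}
  psmulA psmulC psmul1 psmulDl psone_neq0.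

Lemma pscoef1 m : (1 : {mpseries R[N]}) m = (m == 0%MM)%:R.
Proof. by []. Qed.

Lemma pscoefM d f g m :
  (mdeg m < d)%N -> (f * g) m = (pstrunc d f * pstrunc d g)@_m.
Proof. exact: psmulE. Qed.

Definition psunit : {pred {mpseries R[N]}} :=
  [pred f | `[< exists g, g * f = 1 >]].

Definition psinv f : {mpseries R[N]} :=
  if pselect (exists g, g * f = 1) is left ex then projT1 (cid ex) else f.

Lemma psmulVf : {in psunit, left_inverse 1 psinv *%R}.
Proof.
move=> f /asboolP ex; rewrite /psinv; case: pselect => // ex'.
exact: projT2 (cid ex').
Qed.

Lemma psunitPl f g : g * f = 1 -> psunit f.
Proof. by move=> gf1; apply/asboolP; exists g. Qed.

Lemma psinv_out : {in [predC psunit], psinv =1 id}.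
Proof.
move=> f /negP nf; rewrite /psinv; case: pselect => // ex.
by case: nf; apply/asboolP.
Qed.

HB.instance Definition _ := GRing.ComNzRing_hasMulInverse.Build
  {mpseries R[N]} psmulVf psunitPl psinv_out.

Definition ps_of_mpoly (q : {mpoly R[N]}) : {mpseries R[N]} :=
  MPSeries (fun m => q@_m).

Lemma ps_of_mpoly_zmod : zmod_morphism ps_of_mpoly.
Proof. by move=> p q; apply/mpseriesP => m /=; rewrite mcoeffB. Qed.

Lemma ps_of_mpoly_monoid : monoid_morphism ps_of_mpoly.
Proof.
split=> [|p q]; apply/mpseriesP => m /=; first by rewrite mcoeff1.
by rewrite mcoeffM.
Qed.

HB.instance Definition _ := GRing.isZmodMorphism.Build
  {mpoly R[N]} {mpseries R[N]} ps_of_mpoly ps_of_mpoly_zmod.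
HB.instance Definition _ := GRing.isMonoidMorphism.Build
  {mpoly R[N]} {mpseries R[N]} ps_of_mpoly ps_of_mpoly_monoid.

Definition psderiv (i : 'I_N) f : {mpseries R[N]} :=
  MPSeries (fun m => f (m + U_(i))%MM *+ (m i).+1).

Lemma psderiv_mpoly i (q : {mpoly R[N]}) :
  psderiv i (ps_of_mpoly q) = ps_of_mpoly q^`M(i).
Proof. by apply/mpseriesP => m /=; rewrite mcoeff_deriv. Qed.

Lemma psderivB i f g : psderiv i (f - g) = psderiv i f - psderiv i g.
Proof. by apply/mpseriesP => m /=; rewrite mulrnBl. Qed.

Lemma psderivM i f g :
  psderiv i (f * g) = psderiv i f * g + f * psderiv i g.
Proof.
apply/mpseriesP => m; set d := (mdeg m).+2.
have degU k : mdeg (k + U_(i))%MM = (mdeg k).+1 by rewrite mdegD mdeg1 addn1.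
have derivE h k : (mdeg k <= mdeg m)%N ->
    (pstrunc d h)^`M(i)@_k = (pstrunc d (psderiv i h))@_k.
  move=> le_km; rewrite mcoeff_deriv !mcoeff_pstrunc ?degU //.
  by rewrite ltnS (leq_trans le_km).
have -> : psderiv i (f * g) m = (f * g) (m + U_(i))%MM *+ (m i).+1 by [].
rewrite (@pscoefM d) ?degU // -mcoeff_deriv mderivM mcoeffD.
rewrite pscoefD !(@pscoefM d) ?ltnS //.
by congr (_ + _); apply: mcoeffM_eq => k le_km //; rewrite derivE.
Qed.

End MPSeriesRing.

Section MPSeriesIdomain.
Variables (R : idomainType) (N : nat).
Implicit Types f g : {mpseries R[N]}.

Let hcomp (d : nat) f : {mpoly R[N]} :=
  \sum_(k : 'X_{1..N < d.+1}) (if mdeg k == d then f k else 0) *: 'X_[k].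

Let mcoeff_hcomp d f m :
  (hcomp d f)@_m = if mdeg m == d then f m else 0.
Proof.
have [le_md|lt_dm] := leqP (mdeg m) d.
  exact: (mcoeff_mpoly (fun k => if mdeg k == d then f k else 0)).
rewrite gtn_eqF // /hcomp raddf_sum big1 //= => -[k /= ltk] _.
rewrite mcoeffZ mcoeffX; have [km|] := eqVneq k m; last by rewrite mulr0.
by move: ltk; rewrite km ltnS leqNgt lt_dm.
Qed.

Let order_ex f : f != 0 ->
  exists2 d, hcomp d f != 0 & forall m, (mdeg m < d)%N -> f m = 0.
Proof.
move=> f_neq0.
have [m fm] : exists m, f m != 0.
  apply/not_existsP => f0; case/eqP: f_neq0; apply/mpseriesP => m.
  by apply/eqP; rewrite -[_ == _]negbK; apply/negP/f0.
have exd : exists d, `[< exists2 k, mdeg k = d & f k != 0 >].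
  by exists (mdeg m); apply/asboolP; exists m.
case: (ex_minnP exd) => d /asboolP[k degk fk] mind; exists d.
  apply/eqP => /(congr1 (mcoeff k)); rewrite mcoeff_hcomp degk eqxx mcoeff0.
  exact/eqP.
move=> l lt_ld; apply/eqP; apply: contraTT lt_ld => fl.
by rewrite -leqNgt; apply: mind; apply/asboolP; exists l.
Qed.

Lemma mpseries_integral : GRing.integral_domain_axiom {mpseries R[N]}.
Proof.
move=> f g fg0; apply/norP => -[/order_ex[d fd fmin] /order_ex[e ge gmin]].
have /eqP := mulf_neq0 fd ge; apply; apply/mpolyP => m; rewrite mcoeff0.
rewrite mcoeffM.
have [degm|degm] := eqVneq (mdeg m) (d + e)%N; last first.
  apply: big1 => -[[k1 lt1] [k2 lt2]] /= /eqP mE; rewrite !mcoeff_hcomp.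
  case: eqP => [d1|]; last by rewrite mul0r.
  case: eqP => [d2|]; last by rewrite mulr0.
  by case/eqP: degm; rewrite mE mdegD d1 d2.
transitivity ((f * g) m); last by rewrite fg0.
apply: eq_bigr => -[[k1 lt1] [k2 lt2]] /= /eqP mE; rewrite !mcoeff_hcomp.
have degD : (mdeg k1 + mdeg k2 = d + e)%N by rewrite -mdegD -mE.
case: (ltngtP (mdeg k1) d) => [ltd|gtd|eqd].
- by rewrite fmin // !mul0r.
- rewrite mul0r gmin ?mulr0 //.
  by rewrite -(ltn_add2l (mdeg k1)) degD ltn_add2r.
- by move: degD; rewrite eqd => /addnI ->; rewrite eqxx.
Qed.

HB.instance Definition _ :=
  GRing.ComUnitRing_isIntegral.Build {mpseries R[N]} mpseries_integral.

End MPSeriesIdomain.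

Local Notation "x %:F" := (@FracField.tofrac _ x) : ring_scope.

Section FractionField.
Variables (R : idomainType) (N : nat).

Notation K := {fraction {mpseries R[N]}}.

(* The derivation of the fraction field extending psderiv, by the quotient    *)
(* rule on a representative; fderivE shows that the choice is irrelevant.     *)
Definition fderiv (i : 'I_N) (x : K) : K :=
  let a := \n_(repr x) in let b := \d_(repr x) in
  (psderiv i a * b - a * psderiv i b)%:F / (b ^+ 2)%:F.

Lemma fracE (x : K) : x = (\n_(repr x))%:F / (\d_(repr x))%:F.
Proof.
rewrite -[x in LHS]reprK; set r := repr x; unlock FracField.tofrac.
rewrite -[X in _ * X]FracField.pi_inv -[RHS]FracField.pi_mul.
apply/eqmodP; rewrite /= FracField.equivfE /FracField.mulf /FracField.invf.
have rd : \d_r != 0 := denom_ratioP r.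
rewrite !(numden_Ratio, mulr1, mul1r, mulf_neq0, oner_neq0) //.
by rewrite mulrC.
Qed.

Lemma fderivE i (a b : {mpseries R[N]}) : b != 0 ->
  fderiv i (a%:F / b%:F) =
    (psderiv i a * b - a * psderiv i b)%:F / (b ^+ 2)%:F.
Proof.
move=> b_neq0; rewrite /fderiv; set x := a%:F / b%:F.
have := fracE x; set c := \n_(repr x); set d := \d_(repr x).
have d_neq0 : d != 0 := denom_ratioP _.
have tf_neq0 (h : {mpseries R[N]}) : h != 0 -> h%:F != 0 :> K.
  by rewrite tofrac_eq0.
move=> /eqP; rewrite eqr_div ?tf_neq0 // -!tofracM tofrac_eq => /eqP adcb.
apply/eqP; rewrite eqr_div ?tf_neq0 ?expf_neq0 // -!tofracM tofrac_eq.
have := congr1 (psderiv i) adcb; rewrite !psderivM => dadcb.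
rewrite -subr_eq0; apply/eqP.
move: (psderiv i a) (psderiv i b) (psderiv i c) (psderiv i d) dadcb.
move=> a' b' c' d' dadcb.
transitivity ((b * d' + b' * d) * (a * d - c * b)
              - b * d * (a' * d + a * d' - (c' * b + c * b'))); first by ring.
by rewrite adcb dadcb !subrr !mulr0 subrr.
Qed.

Definition fvar (j : 'I_N) : K := (ps_of_mpoly 'X_j)%:F.

Definition ps_pth (p : nat) : set {mpseries R[N]} :=
  [set f : {mpseries R[N]} | forall m, f m != 0 -> forall i, (p %| m i)%N].

(* The fraction field of R[[lambda_1^p, ..., lambda_N^p]] inside K.           *)
Definition frac_pth (p : nat) : set K :=
  [set x | exists f g, [/\ ps_pth p f, ps_pth p g, g != 0 & x = f%:F / g%:F]].

Lemma ps_pth1 p : ps_pth p 1.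
Proof.
move=> m; rewrite pscoef1.
have [-> _ i|_] := eqVneq m 0%MM; last by rewrite eqxx.
by rewrite mnm0E dvdn0.
Qed.

Lemma ps_pthB p f g : ps_pth p f -> ps_pth p g -> ps_pth p (f - g).
Proof.
move=> fp gp m; rewrite pscoefB => fgm i; apply: contraNT fgm => ndvd.
have [/eqP->|/fp/(_ i)] := boolP (f m == 0); last by rewrite (negPf ndvd).
have [/eqP->|/gp/(_ i)] := boolP (g m == 0); last by rewrite (negPf ndvd).
by rewrite subrr.
Qed.

Lemma ps_pthM p f g : ps_pth p f -> ps_pth p g -> ps_pth p (f * g).
Proof.
move=> fp gp m fgm i; apply: contraNT fgm => ndvd; apply/eqP.
apply: big1 => -[[k1 lt1] [k2 lt2]] /= /eqP mE.
have [/eqP->|/fp/(_ i) dv1] := boolP (f k1 == 0); first by rewrite mul0r.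
have [/eqP->|/gp/(_ i) dv2] := boolP (g k2 == 0); first by rewrite mulr0.
by case/negP: ndvd; rewrite mE mnmDE dvdn_add.
Qed.

Lemma frac_pth_divring p :
  [/\ frac_pth p 1,
      forall x y, frac_pth p x -> frac_pth p y -> frac_pth p (x - y)
    & forall x y, frac_pth p x -> frac_pth p y -> frac_pth p (x / y)].
Proof.
have tf_neq0 (h : {mpseries R[N]}) : h != 0 -> h%:F != 0 :> K.
  by rewrite tofrac_eq0.
split.
- exists 1, 1; split; [exact: ps_pth1 | exact: ps_pth1 | exact: oner_neq0|].
  by rewrite tofrac1 divr1.
- move=> _ _ [f [g [fp gp g0 ->]]] [f' [g' [fp' gp' g0' ->]]].
  exists (f * g' - f' * g), (g * g').
  split; [by apply: ps_pthB; apply: ps_pthM | exact: ps_pthM | exact: mulf_neq0|].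
  rewrite -mulNr addf_div ?tf_neq0 // tofracB !tofracM; congr (_ / _).
  by rewrite mulNr.
- move=> _ _ [f [g [fp gp g0 ->]]] [f' [g' [fp' gp' g0' ->]]].
  have [->|f0'] := eqVneq f' 0.
    exists (1 - 1), 1; rewrite subrr; split; [|exact: ps_pth1|exact: oner_neq0|].
    + by move=> m; rewrite pscoef0 eqxx.
    + by rewrite tofrac0 !mul0r invr0 mulr0.
  exists (f * g'), (g * f').
  split; [exact: ps_pthM | exact: ps_pthM | exact: mulf_neq0|].
  by rewrite invf_div mulf_div !tofracM.
Qed.

End FractionField.

Section VectorSpaces.
Variables (K : fieldType) (S : set K).

Definition is_vector_space_over (V : set K) : Prop :=
  [/\ V 0,
      forall x y, V x -> V y -> V (x + y)
    & forall c x, S c -> V x -> V (c * x)].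

Definition lin_indep_over (B : set K) : Prop :=
  forall (s : seq K) (c : K -> K), uniq s -> (forall b, b \in s -> B b) ->
    (forall b, b \in s -> S (c b)) ->
    \sum_(b <- s) c b * b = 0 -> forall b, b \in s -> c b = 0.

Definition span_over (B : set K) : set K :=
  [set x | exists (s : seq K) (c : K -> K),
    [/\ uniq s, forall b, b \in s -> B b, forall b, b \in s -> S (c b)
      & x = \sum_(b <- s) c b * b]].

Definition is_basis_over (V B : set K) : Prop :=
  lin_indep_over B /\ span_over B = V.

End VectorSpaces.

Section AHypergeometric.
Variables (p N n : nat) (a : 'I_N -> 'rV[int]_n).

Notation K := {fraction {mpseries 'F_p[N]}}.

Definition relation_lattice : set 'rV[int]_N :=
  [set l | \sum_j l 0 j *: a j = 0].

Definition Uplus (gamma : 'rV[int]_n) : set 'X_{1..N} :=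
  [set u | \sum_j a j *+ u j = gamma].

Definition NA : set 'rV[int]_n := [set gamma | exists u, Uplus gamma u].

Definition very_good (gamma : 'rV[int]_n) : Prop :=
  NA gamma /\ forall u, Uplus gamma u -> forall j, (u j <= p.-1)%N.

(* Uplus gamma is finite when gamma is very good; otherwise the finitely      *)
(* supported sum may take a default value, but it is not used in that case.   *)
Definition Gpoly (gamma : 'rV[int]_n) : {mpoly 'F_p[N]} :=
  \sum_(u \in Uplus gamma) ((\prod_j (u j)`!%:R)^-1 : 'F_p) *: 'X_[u].

Definition tau (beta : 'rV[int]_n) : set 'rV[int]_n :=
  [set gamma | (exists z : 'rV[int]_n, gamma = beta + z *+ p) /\
               very_good gamma].

(* The order of composition is immaterial: partial derivatives commute.       *)
Definition box (l : 'rV[int]_N) (G : K) : K :=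
  (\big[comp/idfun]_(j < N | 0 < l 0 j) iter (absz (l 0 j)) (@fderiv _ N j)) G
  - (\big[comp/idfun]_(j < N | l 0 j < 0) iter (absz (l 0 j)) (@fderiv _ N j)) G.

Definition euler (beta : 'rV[int]_n) (i : 'I_n) (G : K) : K :=
  (\sum_j (a j 0 i)%:~R * fvar _ j * fderiv j G) - (beta 0 i)%:~R * G.

Definition solutions (beta : 'rV[int]_n) : set K :=
  [set G | (forall l, relation_lattice l -> box l G = 0) /\
           (forall i, euler beta i G = 0)].

Lemma finite_Uplus gamma : very_good gamma -> finite_set (Uplus gamma).
Proof.
case=> _ vg.
pose F (u : {ffun 'I_N -> 'I_p.-1.+1}) := [multinom (u j : nat) | j < N].
apply: (@sub_finite_set _ _ (F @` setT)); last exact/finite_image/finite_finset.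
move=> u /vg le_u; exists [ffun j => inord (u j)] => //.
by apply/mnmP => j; rewrite mnmE ffunE inordK // ltnS.
Qed.

Lemma mcoeff_Gpoly gamma u : very_good gamma ->
  (Gpoly gamma)@_u =
    if u \in Uplus gamma then (\prod_j (u j)`!%:R)^-1 else 0.
Proof.
move=> vg; rewrite /Gpoly.
have notin (A : set 'X_{1..N}) (c : 'X_{1..N} -> 'F_p) : ~ A u ->
    (\sum_(v \in A) c v *: 'X_[v])@_u = 0.
  move=> Au; rewrite raddf_sum big1_seq //= => v.
  case: finite_supportP => [_|X sXA _ _]; first by rewrite in_nil.
  move=> /sXA Av.
  rewrite mcoeffZ mcoeffX; case: eqP => [vu|]; last by rewrite mulr0.
  by case: Au; rewrite -vu.
case: ifPn => [/set_mem uU|/negP uU]; last first.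
  by rewrite notin // => /mem_set.
rewrite (fsbigD1 u) /=; [|exact: finite_Uplus|exact: uU].
rewrite mcoeffD mcoeffZ mcoeffX eqxx mulr1.
by rewrite (notin _ (fun v => (\prod_j (v j)`!%:R)^-1)) ?addr0 // => -[_]; apply.
Qed.

End AHypergeometric.

Arguments frac_pth R N p : clear implicits.
Arguments Gpoly p {N n} a gamma.
Arguments tau p {N n} a beta.
Arguments solutions p {N n} a beta.

(* Main.v *)
(* A fraction f / g equals f g^(p-1) / g^p, whose denominator is a series in the
   p-th powers of the variables.  The operators are linear over the field of
   fractions of such series, so it suffices to find the power series solutions
   h.  On coefficients, the Euler operators say that h_m <> 0 only if
   sum_j m_j a_j is congruent to beta mod p, and the box operators say that
   h_(pk+u) u! = h_(pk+u') u'! in F_p whenever sum_j u_j a_j = sum_j u'_j a_j.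
   Since u'! = 0 as soon as some u'_j >= p, h_(pk+u) vanishes for u in
   [0,p-1]^N of weight gamma unless gamma is very good, and then the part of h
   of residual weight gamma is a series in the p-th powers times G_gamma.
   Independence holds because the G_gamma have disjoint supports inside
   [0,p-1]^N. *)
Require Import Defs.
From HB Require Import structures.
From mathcomp Require Import all_boot all_order all_algebra.
From mathcomp Require Import generic_quotient fraction.
From mathcomp Require Import boolp classical_sets mpoly zify.
Local Open Scope ring_scope.
Local Open Scope classical_set_scope.

Set Implicit Arguments.
Unset Strict Implicit.
Unset Printing Implicit Defensive.

Import GRing.Theory.

Local Notation "x %:F" := (@FracField.tofrac _ x) : ring_scope.

(** * Coefficients and iterated derivatives of power series *)

Section PowerSeries.
Variables (R : comNzRingType) (N : nat).
Implicit Types (f g : {mpseries R[N]}) (m u v w : 'X_{1..N}).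

(** The exponent comes first so that extraction at [m] can carry an additive morphism structure and
    pass through sums. *)
Definition coefps m f : R := f m.

Lemma coefps_zmod m : zmod_morphism (coefps m).
Proof. by []. Qed.

HB.instance Definition _ m :=
  GRing.isZmodMorphism.Build {mpseries R[N]} R (coefps m) (coefps_zmod m).

Lemma pscoefM_eq0 f g m :
  (forall u v, m = (u + v)%MM -> f u * g v = 0) -> (f * g) m = 0.
Proof.
by move=> fg0; apply: big1 => -[[u ltu] [v ltv]] /= /eqP /fg0.
Qed.

Lemma pscoefM_single f g u v :
  (forall u' v', (u + v = u' + v')%MM -> u' <> u -> f u' * g v' = 0) ->
  (f * g) (u + v)%MM = f u * g v.
Proof.
move=> fg0.
have ltu : (mdeg u < (mdeg (u + v)).+1)%N by rewrite ltnS mdegD leq_addr.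
have ltv : (mdeg v < (mdeg (u + v)).+1)%N by rewrite ltnS mdegD leq_addl.
rewrite [LHS](bigD1 (BMultinom ltu, BMultinom ltv)) //=.
rewrite big1 ?addr0 // => -[[u' ltu'] [v' ltv']] /= /andP[/eqP uvE neq].
apply: fg0 => // u'E; case/negP: neq.
have v'E : v' = v.
  apply/mnmP => i; move/(congr1 (fun m : 'X_{1..N} => m i)): uvE.
  by rewrite u'E !mnmDE => /addnI ->.
by apply/eqP; congr pair; apply: val_inj.
Qed.

(** Closed form of the mixed partial derivative of order [v j] in each variable; the falling
    factorials are the factors picked up by the monomials. *)
Definition psderivn v f : {mpseries R[N]} :=
  MPSeries (fun m => f (m + v)%MM *+ \prod_j (m j + v j) ^_ (v j)).

Lemma psderivn0 f : psderivn 0%MM f = f.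
Proof.
apply/mpseriesP => m /=; rewrite big1 ?mulr1n ?addm0 // => j _.
by rewrite mnm0E.
Qed.

Lemma psderivnU i f : psderivn U_(i)%MM f = psderiv i f.
Proof.
apply/mpseriesP => m /=; congr (_ *+ _).
rewrite (bigD1 i) //= mnm1E eqxx addn1 ffactn1 big1 ?muln1 // => j ji.
by rewrite mnm1E eq_sym (negPf ji).
Qed.

Lemma ffact_add n k l :
  ((n + (k + l)) ^_ (k + l) = (n + k) ^_ k * (n + k + l) ^_ l)%N.
Proof.
elim: l => [|l IH]; first by rewrite !addn0 ffactn0 muln1.
by rewrite !addnS !ffactSS IH addnA mulnCA.
Qed.

Lemma psderivnD v w f : psderivn (v + w)%MM f = psderivn v (psderivn w f).
Proof.
apply/mpseriesP => m /=; rewrite addmA -mulrnA -big_split /=.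
congr (_ *+ _); apply: eq_bigr => j _.
by rewrite !mnmDE ffact_add mulnC.
Qed.

Lemma psderivD i f g : psderiv i (f + g) = psderiv i f + psderiv i g.
Proof. by apply/mpseriesP => m /=; rewrite mulrnDl. Qed.

Lemma psderivX i f n : psderiv i (f ^+ n) = f ^+ n.-1 * psderiv i f *+ n.
Proof.
elim: n => [|n IH].
  rewrite expr0 mulr0n; apply/mpseriesP => m /=.
  by rewrite -mdeg_eq0 mdegD mdeg1 addn1 /= mul0rn.
rewrite exprS psderivM IH /= mulrnAr mulrA -[LHS]addrC mulrSr mulrC.
by case: n {IH} => [|n]; rewrite /= ?mulr0n ?add0r -?exprS // mulrC.
Qed.

Lemma pscoef_euler j f m : (ps_of_mpoly 'X_j * psderiv j f) m = f m *+ m j.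
Proof.
have [mj0|] := posnP (m j).
  rewrite mj0 mulr0n; apply: pscoefM_eq0 => u v mE /=; rewrite mcoeffX.
  case: eqP => [uE|_]; last by rewrite mul0r.
  by move: mj0; rewrite mE -uE mnmDE mnm1E eqxx.
move=> mj; pose v := (m - U_(j))%MM.
have mE : m = (U_(j) + v)%MM.
  apply/mnmP => i; rewrite mnmDE mnmBE mnm1E subnKC //.
  by case: eqP => // <-.
rewrite [in LHS]mE pscoefM_single => [|u' v' _ u'U /=].
  by rewrite /= mcoeffX eqxx mul1r addmC -mE /v mnmBE mnm1E eqxx subn1 prednK.
by rewrite mcoeffX; case: eqP => [/esym|]; rewrite ?mul0r.
Qed.

End PowerSeries.

Arguments coefps : simpl never.

(** * Series in the p-th powers as constants of differentiation *)

Section FrobeniusConstants.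
Variables (p : nat) (R : idomainType) (N : nat).
Hypothesis charRp : p \in [pchar R].
Notation K := {fraction {mpseries R[N]}}.
Implicit Types (f g h q : {mpseries R[N]}) (x y c : K).

(** For the converse, multiplying the [i]-th derivative by the [i]-th variable scales the
    coefficient at [m] by [m i]; so where the coefficient is nonzero, [m i] must vanish in [R]. *)
Lemma ps_pthP q : ps_pth p q <-> forall i, psderiv i q = 0.
Proof.
split=> [qp i|dq m qm i].
  apply/mpseriesP => m /=; have [->|/qp/(_ i)] := eqVneq (q (m + U_(i))%MM) 0.
    by rewrite mul0rn.
  rewrite mnmDE mnm1E eqxx addn1 (dvdn_pcharf charRp) => /eqP mi0.
  by rewrite -mulr_natr mi0 mulr0.
have [->|mi] := posnP (m i); first exact: dvdn0.
rewrite (dvdn_pcharf charRp).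
have := pscoef_euler i q m; rewrite dq mulr0 pscoef0 => /esym/eqP.
by rewrite -[q m *+ _]mulr_natr mulf_eq0 (negPf qm).
Qed.

(* [q ^+ p] has vanishing partial derivatives, hence is a series in the
   [p]-th powers of the variables; no expansion of the power is needed. *)
Lemma ps_pthX q : ps_pth p (q ^+ p).
Proof.
apply/ps_pthP => i; rewrite psderivX; apply/mpseriesP => m.
rewrite -[LHS]/(coefps m _) raddfMn /= -mulr_natr.
by rewrite (pcharf0 charRp) mulr0.
Qed.

Lemma frac_pth_repr x :
  exists h q, [/\ ps_pth p q, q != 0 & x = h%:F / q%:F].
Proof.
have := fracE x; set f := \n_(repr x); set g := \d_(repr x) => ->.
have g0 : g != 0 := denom_ratioP _.
exists (f * g ^+ p.-1), (g ^+ p); split; [exact: ps_pthX|exact: expf_neq0|].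
have p0 : (0 < p)%N by apply/prime_gt0/(pcharf_prime charRp).
have gF : (g ^+ p.-1)%:F != 0 :> K by rewrite tofrac_eq0 expf_neq0.
by rewrite -{2}(prednK p0) exprS !tofracM invfM mulrACA divff // mulr1.
Qed.

(** The derivatives of [q] vanish, so the quotient rule differentiates the numerator only. *)
Lemma fderiv_pth i h q : ps_pth p q -> q != 0 ->
  fderiv i (h%:F / q%:F) = (psderiv i h)%:F / q%:F.
Proof.
move=> /ps_pthP/(_ i) dq q0; rewrite fderivE // dq mulr0 subr0.
have qF : q%:F != 0 :> K by rewrite tofrac_eq0.
by rewrite expr2 !tofracM invfM mulrACA divff // mulr1.
Qed.

Lemma fderiv_tofrac i h : fderiv i h%:F = (psderiv i h)%:F.
Proof.
have := fderiv_pth i h (@ps_pth1 _ _ p) (oner_neq0 _).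
by rewrite tofrac1 !divr1.
Qed.

(** Being closed under composition, this property passes from single derivatives to the composites
    inside the box operators. *)
Definition pth_linear (T : K -> K) : Prop :=
  {morph T : x y / x + y} /\
  forall c x, frac_pth R N p c -> T (c * x) = c * T x.

Lemma pth_linear_fderiv i : pth_linear (fderiv i).
Proof.
split=> [x y|c y].
  have [h [q [qp q0 ->]]] := frac_pth_repr x.
  have [h' [q' [qp' q0' ->]]] := frac_pth_repr y.
  have qF : q%:F != 0 :> K by rewrite tofrac_eq0.
  have qF' : q'%:F != 0 :> K by rewrite tofrac_eq0.
  rewrite addf_div // -!tofracM -tofracD !fderiv_pth //; last exact: mulf_neq0.
    rewrite addf_div // -!tofracM -tofracD; congr (_%:F / _).
    rewrite psderivD !psderivM.
    move/ps_pthP: qp => ->; move/ps_pthP: qp' => ->.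
    by rewrite !mulr0 !addr0.
  exact: ps_pthM.
have [h [q [qp q0 ->]]] := frac_pth_repr y.
case=> f [g [fp gp g0 ->]].
rewrite mulf_div -!tofracM !fderiv_pth //; last exact: mulf_neq0.
  rewrite mulf_div -!tofracM psderivM.
  by move/ps_pthP/(_ i): fp => ->; rewrite mul0r add0r.
exact: ps_pthM.
Qed.

Lemma pth_linear_id : pth_linear idfun.
Proof. by []. Qed.

Lemma pth_linear_comp T U :
  pth_linear T -> pth_linear U -> pth_linear (T \o U).
Proof.
move=> [TD TZ] [UD UZ]; split=> [x y|c x Sc] /=; first by rewrite UD TD.
by rewrite UZ // TZ.
Qed.

Lemma pth_linear_iter n T : pth_linear T -> pth_linear (iter n T).
Proof.
by move=> linT; elim: n => [|n IH]; [exact: pth_linear_id|exact: pth_linear_comp].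
Qed.

Lemma pth_linear_bigcomp (P : pred 'I_N) (e : 'I_N -> nat) :
  pth_linear (\big[comp/idfun]_(j < N | P j) iter (e j) (@fderiv R N j)).
Proof.
apply: (big_ind pth_linear); [exact: pth_linear_id|exact: pth_linear_comp|].
by move=> j _; apply/pth_linear_iter/pth_linear_fderiv.
Qed.

Lemma bigcomp_tofrac (P : pred 'I_N) (e : 'I_N -> nat) h :
  (\big[comp/idfun]_(j < N | P j) iter (e j) (@fderiv R N j)) h%:F =
  (psderivn (\sum_(j < N | P j) U_(j) *+ e j)%MM h)%:F.
Proof.
move: h; apply: (big_rec2 (fun T v => forall h, T h%:F = (psderivn v h)%:F)).
  by move=> h; rewrite psderivn0.
move=> j T v _ IH h /=; rewrite IH psderivnD.
elim: (e j) (psderivn v h) => [|k IHk] g; first by rewrite mulm0n psderivn0.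
by rewrite iterS IHk fderiv_tofrac mulmS psderivnD psderivnU.
Qed.

End FrobeniusConstants.

(** * Sums and spans over a set of scalars *)

Section VectorSpaces.
Variables (K : fieldType) (S : set K).

Lemma vector_space_sum (V : set K) (I : eqType) (r : seq I) (F : I -> K) :
  is_vector_space_over S V -> (forall i, i \in r -> V (F i)) ->
  V (\sum_(i <- r) F i).
Proof.
move=> [V0 VD _] VF; rewrite big_seq.
by apply: (big_ind V) => //; apply: VD.
Qed.

(** [span_over] requires a list of vectors without repetition, whereas [F] may repeat values; the
    coefficients of equal vectors are added up. *)
Lemma span_over_sum (B : set K) (I : eqType) (r : seq I) (c F : I -> K) :
  is_vector_space_over S S ->
  (forall i, i \in r -> S (c i)) -> (forall i, i \in r -> B (F i)) ->
  span_over S B (\sum_(i <- r) c i * F i).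
Proof.
move=> vsS Sc BF.
exists (undup (map F r)), (fun b => \sum_(i <- r | F i == b) c i).
split=> [|b|b _|]; first exact: undup_uniq.
- by rewrite mem_undup => /mapP[i ir ->]; apply: BF.
- case: vsS => S0 SD _; rewrite big_seq_cond; apply: (big_ind S) => //.
  by move=> i /andP[ir _]; apply: Sc.
(* After the two sums are exchanged, each index [i] contributes for exactly one vector, [F i]. *)
under [RHS]eq_bigr do rewrite big_distrl /= big_mkcond.
rewrite exchange_big /= [LHS]big_seq [RHS]big_seq; apply: eq_bigr => i ir.
rewrite -big_mkcond /= (big_rem (F i)) /=; last by rewrite mem_undup map_f.
rewrite eqxx big1_seq ?addr0 // => b /andP[/eqP <-].
by rewrite mem_rem_uniq ?undup_uniq // inE eqxx.
Qed.

End VectorSpaces.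

(** * Weights and factorials modulo p *)

Section AHypergeometric.
Variables (p N n : nat) (a : 'I_N -> 'rV[int]_n).
Hypothesis hp : prime p.
Notation K := {fraction {mpseries 'F_p[N]}}.
Implicit Types (h f g : {mpseries 'F_p[N]}) (m u v w k r : 'X_{1..N}).
Implicit Types (l : 'rV[int]_N) (beta gamma : 'rV[int]_n).

Let charFp : p \in [pchar 'F_p] := pchar_Fp hp.

Definition weight u : 'rV[int]_n := \sum_j a j *+ u j.

Lemma weightD u v : weight (u + v)%MM = weight u + weight v.
Proof.
by rewrite -big_split /=; apply: eq_bigr => j _; rewrite mnmDE mulrnDr.
Qed.

Lemma weightMn u d : weight (u *+ d)%MM = weight u *+ d.
Proof.
by rewrite -sumrMnl; apply: eq_bigr => j _; rewrite mulmnE mulrnA.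
Qed.

Definition mfact u : 'F_p := \prod_j (u j)`!%:R.

Lemma natr_fact_Fp_eq0 d : (d`!%:R == 0 :> 'F_p) = (p <= d)%N.
Proof.
rewrite -(dvdn_pcharf charFp).
have p_gt1 := prime_gt1 hp; elim: d => [|d IH].
  by rewrite fact0 dvdn1 leqNgt ltnW // gtn_eqF.
rewrite factS Euclid_dvdM // IH [in RHS]leq_eqVlt ltnS.
have [_|ltdp] := leqP p d; rewrite ?orbT ?orbF //.
apply/idP/eqP => [/dvdn_leq -/(_ isT) le|->]; last exact: dvdnn.
by apply/eqP; rewrite eqn_leq le.
Qed.

Lemma mfact_neq0 u : (forall j, u j < p)%N -> mfact u != 0.
Proof.
by move=> ltu; apply/prodf_neq0 => j _; rewrite natr_fact_Fp_eq0 -ltnNge.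
Qed.

Lemma mfact_eq0 u j : (p <= u j)%N -> mfact u = 0.
Proof.
rewrite -natr_fact_Fp_eq0 => /eqP uj.
by rewrite /mfact (bigD1 j) //= uj mul0r.
Qed.

(** Modulo [p] the multiple of [p] drops out of the falling factorial, leaving the quotient of
    [(s + d)!] by [s!]. It is stated as a product because [s!] may be zero in ['F_p]. *)
Lemma natr_ffact_fact (k d s : nat) :
  ((k * p + s + d) ^_ d)%:R * s`!%:R = (s + d)`!%:R :> 'F_p.
Proof.
elim: d => [|d IH]; first by rewrite ffactn0 mul1r addn0.
rewrite !addnS ffactSS factS !natrM -IH mulrA; congr (_ * _ * _).
by rewrite -addnA -addnS natrD natrM (pcharf0 charFp) mulr0 add0r.
Qed.

(** Once coefficients are weighted by factorials, differentiation becomes a mere shift of the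
    exponent. *)
Lemma psderivn_mfact h k (s d : 'X_{1..N}) :
  psderivn d h (k *+ p + s)%MM * mfact s =
  h (k *+ p + (s + d))%MM * mfact (s + d)%MM.
Proof.
rewrite /= addmA -mulr_natr -mulrA; congr (_ * _).
rewrite natr_prod -big_split /=; apply: eq_bigr => j _.
by rewrite !mnmDE mulmnE natr_ffact_fact.
Qed.

(** * Box and Euler operators on coefficients *)

(** The positive and negative parts of [l], written as the sums that [bigcomp_tofrac] produces from
    the two composites in [box]. *)
Definition mpos l : 'X_{1..N} :=
  (\sum_(j < N | (0 < l 0 j)%R) U_(j) *+ absz (l 0%R j))%MM.
Definition mneg l : 'X_{1..N} :=
  (\sum_(j < N | (l 0 j < 0)%R) U_(j) *+ absz (l 0%R j))%MM.

Lemma sum_mulmnU (P : pred 'I_N) (e : 'I_N -> nat) i :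
  (\sum_(j < N | P j) U_(j) *+ e j)%MM i = if P i then e i else 0%N.
Proof.
rewrite mnm_sumE big_mkcond (bigD1 i) //= big1 ?addn0.
  by case: ifP => // _; rewrite mulmnE mnm1E eqxx mul1n.
move=> j ji; case: ifP => // _.
by rewrite mulmnE mnm1E (negPf ji) mul0n.
Qed.

Lemma weight_mpos l : relation_lattice a l -> weight (mpos l) = weight (mneg l).
Proof.
move=> lL; apply/eqP; rewrite -subr_eq0 -[X in _ == X]lL -sumrB; apply/eqP.
apply: eq_bigr => j _; rewrite !sum_mulmnU -[l 0 j in RHS]intz scaler_int.
by case: (l 0 j) => [[|d]|d] //=; rewrite ?mulr0n ?subr0 ?sub0r // NegzE.
Qed.

Lemma box_tofrac l h :
  box l h%:F = (psderivn (mpos l) h - psderivn (mneg l) h)%:F.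
Proof. by rewrite /box !(bigcomp_tofrac charFp) tofracB. Qed.

(* [u] and [u'] may have entries [>= p], where [mfact] vanishes. *)
Lemma box_mfact h k u u' :
  (forall l, relation_lattice a l -> box l h%:F = 0) ->
  weight u = weight u' ->
  h (k *+ p + u)%MM * mfact u = h (k *+ p + u')%MM * mfact u'.
Proof.
move=> boxh wu; pose l : 'rV[int]_N := \row_j ((u j)%:Z - (u' j)%:Z).
have posl : mpos l = (u - u')%MM.
  apply/mnmP => j; rewrite sum_mulmnU mnmBE mxE.
  by case: ifP; lia.
have negl : mneg l = (u' - u)%MM.
  apply/mnmP => j; rewrite sum_mulmnU mnmBE mxE.
  by case: ifP; lia.
have lL : relation_lattice a l.
  apply/eqP; rewrite -[X in _ == X](subrr (weight u)) {2}wu -sumrB; apply/eqP.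
  by apply: eq_bigr => j _; rewrite mxE -[X in X *: _]intz scaler_int mulrzBr.
have /eqP := boxh _ lL; rewrite box_tofrac tofrac_eq0 subr_eq0 posl negl => /eqP.
(* The entrywise minimum completes both truncated differences: adding [u - u'] to [s] gives [u], and
   adding [u' - u] gives [u']. *)
pose s : 'X_{1..N} := [multinom minn (u j) (u' j) | j < N].
move/(congr1 (fun f : {mpseries 'F_p[N]} => f (k *+ p + s)%MM * mfact s)).
rewrite !psderivn_mfact; congr (h (_ + _)%MM * mfact _ = h (_ + _)%MM * mfact _);
  by apply/mnmP => j; rewrite mnmDE mnmBE mnmE; lia.
Qed.

(** The Euler operator is diagonal on monomials, with eigenvalue the [i]-th entry of
    [weight m - beta] at exponent [m]. *)
Lemma euler_tofrac beta i h : euler a beta i h%:F = 0 <->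
  forall m, h m *~ (weight m - beta) 0 i = 0.
Proof.
pose E : {mpseries 'F_p[N]} :=
  \sum_j (ps_of_mpoly 'X_j * psderiv j h) *~ a j 0 i - h *~ beta 0 i.
have -> : euler a beta i h%:F = E%:F.
  rewrite /euler tofracB rmorph_sum /= rmorphMz /= mulrzl; congr (_ - _).
  apply: eq_bigr => j _; rewrite (fderiv_tofrac charFp) rmorphMz /= tofracM.
  by rewrite -mulrA mulrzl.
have Em m : E m = h m *~ (weight m - beta) 0 i.
  rewrite -[LHS]/(coefps m E) raddfB raddf_sum raddfMz /= !mxE mulrzBr summxE.
  congr (_ - _); rewrite mulrz_sumr; apply: eq_bigr => j _.
  rewrite raddfMz (_ : _ *~ a j 0 i = h m *+ m j *~ a j 0 i); last first.
    by congr (_ *~ _); exact: pscoef_euler.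
  rewrite mulmxnE.
  by rewrite !pmulrn mulrzz -mulrzA mulrC.
split=> [/eqP|h0].
  by rewrite tofrac_eq0 => /eqP E0 m; rewrite -Em E0.
by apply/eqP; rewrite tofrac_eq0; apply/eqP/mpseriesP => m; rewrite Em h0.
Qed.

Lemma euler_coef beta h m : (forall i, euler a beta i h%:F = 0) -> h m != 0 ->
  exists z, weight m = beta + z *+ p.
Proof.
move=> eulh hm.
have dv i : (p %| (weight m - beta)%R 0%R i)%Z.
  have /euler_tofrac/(_ m)/eqP := eulh i.
  by rewrite -mulrzr mulf_eq0 (negPf hm) /= -(dvdz_pcharf charFp).
exists (\row_i ((weight m - beta)%R 0%R i %/ p)%Z).
apply/rowP => i; rewrite !mxE mulmxnE mxE pmulrn mulrzz divzK ?dv //.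
by rewrite !mxE addrC subrK.
Qed.

Lemma euler_coef_eq beta h i :
  (forall m, h m != 0 -> exists z, weight m = beta + z *+ p) ->
  euler a beta i h%:F = 0.
Proof.
move=> wh; apply/euler_tofrac => m.
have [->|/wh[z ->]] := eqVneq (h m) 0; first by rewrite mul0rz.
rewrite addrC addKr mulmxnE pmulrn mulrzz mulrC mulrzA.
by rewrite -pmulrn -mulr_natr (pcharf0 charFp) mulr0 mul0rz.
Qed.

(** * The solutions as a vector space *)

Lemma pth_linear_box l : pth_linear p (box l : K -> K).
Proof.
have lin P := pth_linear_bigcomp charFp P (fun j => absz (l 0 j)).
have [pD pZ] := lin (fun j => 0 < l 0 j).
have [nD nZ] := lin (fun j => l 0 j < 0).
split=> [x y|c x Sc]; rewrite /box; first by rewrite pD nD opprD addrACA.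
by rewrite pZ // nZ // mulrBr.
Qed.

Lemma pth_linear_euler beta i : pth_linear p (euler a beta i : K -> K).
Proof.
split=> [x y|c x Sc]; rewrite /euler.
  rewrite mulrDr opprD addrACA -big_split; congr (_ + _).
  apply: eq_bigr => j _; have [-> _] := pth_linear_fderiv charFp j.
  exact: mulrDr.
rewrite mulrBr mulr_sumr [c * (_ * x)]mulrCA; congr (_ - _).
apply: eq_bigr => j _; have [_ ->//] := pth_linear_fderiv charFp j.
by rewrite mulrCA.
Qed.

Lemma solutions_vector_space beta :
  is_vector_space_over (frac_pth 'F_p N p) (solutions p a beta).
Proof.
have lin0 (T : K -> K) : pth_linear p T -> T 0 = 0.
  by case=> TD _; apply: (addrI (T 0)); rewrite -TD !addr0.
split; first by
  split=> [l _|i]; apply: lin0; [exact: pth_linear_box|exact: pth_linear_euler].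
- move=> x y [bx ex] [by_ ey]; split=> [l lL|i].
    by have [-> _] := pth_linear_box l; rewrite bx // by_ // addr0.
  by have [-> _] := pth_linear_euler beta i; rewrite ex ey addr0.
- move=> c x Sc [bx ex]; split=> [l lL|i].
    by have [_ ->//] := pth_linear_box l; rewrite bx // mulr0.
  by have [_ ->//] := pth_linear_euler beta i; rewrite ex mulr0.
Qed.

(** Sums and products come from differences and quotients: [x + y = x - (0 - y)] and
    [x * y = x / (1 / y)], the latter also for [y = 0] since the inverse of 0 is 0. *)
Lemma frac_pth_vector_space :
  is_vector_space_over (frac_pth 'F_p N p) (frac_pth 'F_p N p).
Proof.
have [S1 SB SV] := @frac_pth_divring 'F_p N p.
have S0 : frac_pth 'F_p N p 0 by rewrite -(subrr 1); apply: (SB).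
split=> // x y Sx Sy.
  by rewrite -[y]opprK; apply: (SB) => //; rewrite -sub0r; apply: (SB).
by rewrite -[y]invrK; apply: (SV) => //; rewrite -[y^-1]mul1r; apply: (SV).
Qed.

(** * The polynomials of very good weights are solutions *)

Definition Gseries gamma : {mpseries 'F_p[N]} := ps_of_mpoly (Gpoly p a gamma).

Lemma very_good_lt gamma u : very_good p a gamma -> weight u = gamma ->
  forall j, (u j < p)%N.
Proof.
by move=> [_ vg] /vg le j; rewrite -(prednK (prime_gt0 hp)) ltnS.
Qed.

Lemma very_good_weight gamma :
  very_good p a gamma -> exists u, weight u = gamma.
Proof. by case. Qed.

Lemma Gseries_coef gamma u : very_good p a gamma ->
  Gseries gamma u = if weight u == gamma then (mfact u)^-1 else 0.
Proof.
move=> vg; rewrite /= mcoeff_Gpoly //.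
by have [uE|uE] := eqVneq; [rewrite mem_set|rewrite memNset //; apply/eqP].
Qed.

Lemma Gseries_lt gamma : very_good p a gamma ->
  forall u, Gseries gamma u != 0 -> forall j, (u j < p)%N.
Proof.
move=> vg u; rewrite Gseries_coef //.
case: (weight u =P gamma) => [wu _|_]; last by rewrite eqxx.
exact: very_good_lt vg wu.
Qed.

(** Each derivative of a divided monomial is again a divided monomial or zero; when [m + v] has
    weight [gamma] its entries are below [p], so [mfact m] is invertible. The result depends on [v]
    only through its weight, which makes the two terms of a box operator cancel. *)
Lemma Gseries_psderivn gamma v m : very_good p a gamma ->
  psderivn v (Gseries gamma) m =
    if weight (m + v)%MM == gamma then (mfact m)^-1 else 0.
Proof.
move=> vg; have [wmv|wmv] := eqVneq; last first.
  by rewrite -[LHS]/(Gseries gamma _ *+ _) Gseries_coef // (negPf wmv) mul0rn.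
have ltmv := very_good_lt vg wmv.
have ltm j : (m j < p)%N.
  by apply: leq_ltn_trans (ltmv j); rewrite mnmDE leq_addr.
apply: (mulIf (mfact_neq0 ltm)); rewrite mulVf ?mfact_neq0 //.
have := psderivn_mfact (Gseries gamma) 0%MM m v.
have -> : (0 *+ p)%MM = 0%MM :> 'X_{1..N}.
  by apply/mnmP => j; rewrite mulmnE mnm0E.
rewrite !add0m => ->; rewrite Gseries_coef // wmv eqxx.
by rewrite mulVf ?mfact_neq0.
Qed.

Lemma Gseries_solution beta gamma : tau p a beta gamma ->
  solutions p a beta (Gseries gamma)%:F.
Proof.
move=> [[z gE] vg]; split=> [l lL|i].
  rewrite box_tofrac; apply/eqP; rewrite tofrac_eq0 subr_eq0.
  apply/eqP/mpseriesP => m; rewrite !Gseries_psderivn //.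
  by rewrite !weightD weight_mpos.
apply: euler_coef_eq => m; rewrite Gseries_coef //.
case: (weight m =P gamma) => [->|].
  by exists z.
by rewrite eqxx.
Qed.

(** * Division of exponents by p, and linear independence *)

Lemma mnm_divmod m : exists k r,
  (forall j, r j < p)%N /\ m = (k *+ p + r)%MM.
Proof.
exists [multinom (m j %/ p)%N | j < N], [multinom (m j %% p)%N | j < N].
split=> [j|]; first by rewrite mnmE ltn_mod prime_gt0.
by apply/mnmP => j; rewrite mnmDE mulmnE !mnmE -divn_eq.
Qed.

(* Euclidean division by [p] makes the decomposition of an exponent unique. *)
Lemma pscoefM_pth f g k r : ps_pth p f ->
  (forall m, g m != 0 -> forall j, (m j < p)%N) -> (forall j, r j < p)%N ->
  (f * g) (k *+ p + r)%MM = f (k *+ p)%MM * g r.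
Proof.
move=> fp gp rp; apply: pscoefM_single => u v uvE neq.
have [->|/fp dvu] := eqVneq (f u) 0; first by rewrite mul0r.
have [->|/gp ltv] := eqVneq (g v) 0; first by rewrite mulr0.
case: neq; apply/mnmP => j.
have /(congr1 (fun m : 'X_{1..N} => m j %/ p)%N) := uvE.
rewrite !mnmDE mulmnE -(divnK (dvu j)) !divnMDl ?prime_gt0 //.
by rewrite (divn_small (rp j)) (divn_small (ltv j)) !addn0 => ->.
Qed.

Lemma ps_pth_eq0 f : ps_pth p f -> (forall k, f (k *+ p)%MM = 0) -> f = 0.
Proof.
move=> fp f0; apply/mpseriesP => m; have [//|fm] := eqVneq (f m) 0.
have -> : m = ([multinom (m j %/ p)%N | j < N] *+ p)%MM.
  by apply/mnmP => j; rewrite mulmnE mnmE divnK //; apply: fp.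
exact: f0.
Qed.

Lemma frac_pth_common_denom (s : seq K) (c : K -> K) :
  (forall b, b \in s -> frac_pth 'F_p N p (c b)) ->
  exists2 q : {mpseries 'F_p[N]}, q != 0 &
    forall b, b \in s -> exists2 f, ps_pth p f & c b * q%:F = f%:F.
Proof.
(* The induction keeps [q] in [ps_pth], so that a numerator multiplied by it remains a series in the
   p-th powers. *)
suff H : (forall b, b \in s -> frac_pth 'F_p N p (c b)) ->
  exists q : {mpseries 'F_p[N]}, [/\ ps_pth p q, q != 0 &
    forall b, b \in s -> exists2 f, ps_pth p f & c b * q%:F = f%:F].
  by case/H => q [_ q0 qs]; exists q.
elim: s => [|b0 s IH] Sc.
  by exists 1; split; [exact: ps_pth1|exact: oner_neq0|].
have [|q [qp q0 qs]] := IH; first by move=> b bs; apply: Sc; rewrite inE bs orbT.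
have [f0 [g0 [fp gp gn0 cE]]] := Sc b0 (mem_head _ _).
exists (g0 * q); split; [exact: ps_pthM|exact: mulf_neq0|move=> b].
rewrite inE => /predU1P[->|/qs[f fp' cb]].
  exists (f0 * q); first exact: ps_pthM.
  by rewrite cE tofracM -mulrA mulKf ?tofrac_eq0 // tofracM.
exists (g0 * f); first exact: ps_pthM.
by rewrite tofracM mulrCA cb tofracM.
Qed.

Lemma Gseries_lin_indep beta : lin_indep_over (frac_pth 'F_p N p)
  [set (Gseries gamma)%:F | gamma in tau p a beta].
Proof.
move=> s c us Bs Sc sum0 b0 b0s.
have [q q0 cq] := frac_pth_common_denom Sc.
(* Membership in [s] sits under the existential so that [choice] gives a total function; outside [s]
   the value is a dummy 0. *)
have /choice[F FE] b : exists f, b \in s -> ps_pth p f /\ c b * q%:F = f%:F.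
  have [bs|nbs] := boolP (b \in s); last by exists 0.
  by have [f fp cb] := cq _ bs; exists f.
have /choice[ga gaE] b : exists gamma, b \in s ->
    tau p a beta gamma /\ (Gseries gamma)%:F = b.
  have [bs|nbs] := boolP (b \in s); last by exists 0.
  by have [gamma tg gE] := Bs _ bs; exists gamma.
have sumF : \sum_(b <- s) F b * Gseries (ga b) = 0.
  apply/eqP; rewrite -tofrac_eq0 rmorph_sum /=; apply/eqP.
  transitivity ((\sum_(b <- s) c b * b) * q%:F); last by rewrite sum0 mul0r.
  rewrite mulr_suml [LHS]big_seq [RHS]big_seq.
  apply: eq_bigr => b bs; have [_ cb] := FE b bs; have [_ gb] := gaE b bs.
  by rewrite tofracM gb -cb mulrAC.
have [Fp cb0] := FE _ b0s; have [[_ vg0] gb0] := gaE _ b0s.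
have [r wr] := very_good_weight vg0; have ltr := very_good_lt vg0 wr.
suff F0 : F b0 = 0.
  by move/eqP: cb0; rewrite F0 tofrac0 mulf_eq0 tofrac_eq0 (negPf q0) orbF => /eqP.
apply: ps_pth_eq0 => // k.
(* At this exponent only the term of [b0] survives: any other [b] has a different weight [ga b], and
   its polynomial has coefficient zero at [r]. *)
have /(congr1 (coefps (k *+ p + r)%MM)) := sumF.
rewrite raddf_sum raddf0 /= (bigD1_seq b0) //= big1_seq ?addr0.
  rewrite [coefps _ _]pscoefM_pth //; last exact: Gseries_lt.
  move/eqP; rewrite mulf_eq0 Gseries_coef // wr eqxx invr_eq0.
  by rewrite (negPf (mfact_neq0 ltr)) orbF => /eqP.
move=> b /andP[neq bs]; have [Fpb _] := FE _ bs; have [[_ vgb] gb] := gaE _ bs.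
rewrite [coefps _ _]pscoefM_pth //; last exact: Gseries_lt.
rewrite Gseries_coef // wr; case: eqP => [gE|_]; last exact: mulr0.
by case/eqP: neq; rewrite -gb -gb0 gE.
Qed.

(** * Spanning *)

(** A very good element is the weight of an exponent with all entries below [p], and there are
    finitely many of these. *)
Lemma tau_finite beta : exists2 t : seq 'rV[int]_n, uniq t &
  forall gamma, gamma \in t <-> tau p a beta gamma.
Proof.
pose W (r : {ffun 'I_N -> 'I_p}) := weight [multinom (r j : nat) | j < N].
exists (undup [seq gamma <- codom W | `[< tau p a beta gamma >]]) => [|gamma].
  exact: undup_uniq.
rewrite mem_undup mem_filter; split=> [/andP[/asboolP//]|tg].
apply/andP; split; first exact/asboolP.
have [_ vg] := tg.
have [r wr] := very_good_weight vg; have ltr := very_good_lt vg wr.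
apply/codomP; exists [ffun j => Ordinal (ltr j)].
by rewrite -wr; congr weight; apply/mnmP => j; rewrite mnmE ffunE.
Qed.

Lemma series_solution_span beta h : solutions p a beta h%:F ->
  exists (t : seq 'rV[int]_n) (c : 'rV[int]_n -> {mpseries 'F_p[N]}),
    [/\ forall gamma, gamma \in t -> tau p a beta gamma,
        forall gamma, ps_pth p (c gamma)
      & h = \sum_(gamma <- t) c gamma * Gseries gamma].
Proof.
move=> [boxh eulh]; have [t ut tE] := tau_finite beta.
(* An arbitrary exponent of weight [gamma]; the default 0 is never taken for [gamma] in [t]. *)
pose rep gamma := xget 0%MM (Uplus a gamma).
(* By [box_mfact] the coefficient at [k *+ p] equals [h (k *+ p + r) * mfact r] for every [r] of
   weight [gamma], so multiplying it by the coefficient [(mfact r)^-1] of the polynomial restores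
   [h]. *)
pose c gamma : {mpseries 'F_p[N]} := MPSeries (fun m =>
  if [forall j, p %| m j]%N then h (m + rep gamma)%MM * mfact (rep gamma) else 0).
have cp gamma : ps_pth p (c gamma).
  move=> m /= + j; case: ifP => [/forallP//|_].
  by rewrite eqxx.
exists t, c; split=> // [gamma /tE//|].
apply/mpseriesP => m; have [k [r [ltr ->]]] := mnm_divmod m.
rewrite -[RHS]/(coefps _ _) raddf_sum /=.
have coefc gamma : gamma \in t ->
    coefps (k *+ p + r)%MM (c gamma * Gseries gamma) =
    if weight r == gamma then h (k *+ p + r)%MM else 0.
  move=> /tE[_ vg]; rewrite [coefps _ _]pscoefM_pth //; last exact: Gseries_lt.
  rewrite Gseries_coef //; case: eqP => [wr|_]; last exact: mulr0.
  have wrep : weight (rep gamma) = gamma by have [/(xgetPex 0%MM)] := vg.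
  have -> : c gamma (k *+ p)%MM = h (k *+ p + rep gamma)%MM * mfact (rep gamma).
    rewrite /=; case: ifP => // /negP[]; apply/forallP => j.
    by rewrite mulmnE dvdn_mull.
  by rewrite (box_mfact k boxh (u' := r)) ?mulfK ?mfact_neq0 // wrep.
rewrite big_seq (eq_bigr _ coefc) -big_seq -big_mkcond /=.
have [wt|wt] := boolP (weight r \in t).
  rewrite (big_rem (weight r)) //= eqxx big1_seq ?addr0 // => gamma.
  by case/andP=> /eqP <-; rewrite mem_rem_uniq // inE eqxx.
rewrite big1_seq => [|gamma /andP[/eqP<-]]; last by rewrite (negPf wt).
(* A nonzero coefficient would put [weight r] in [tau]: the Euler operators give the congruence, and
   an exponent [u] of the same weight with an entry at least [p] would, by [box_mfact], make the
   coefficient zero. *)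
have [//|hm] := eqVneq (h (k *+ p + r)%MM) 0; case/negP: wt; apply/tE; split.
  have [z] := euler_coef eulh hm; rewrite weightD weightMn => wE.
  (* Dropping [k *+ p] from the exponent changes the multiple of [p] by [weight k]. *)
  by exists (z - weight k); rewrite mulrnBl addrA -wE addrAC subrr add0r.
split; first by exists r.
move=> u wu j; rewrite -ltnS prednK ?prime_gt0 // ltnNge; apply/negP => leu.
move/eqP: hm; apply; apply: (mulIf (mfact_neq0 ltr)).
by rewrite (box_mfact k boxh (u' := u)) // (mfact_eq0 leu) mulr0 mul0r.
Qed.

Lemma solutions_span beta :
  span_over (frac_pth 'F_p N p) [set (Gseries gamma)%:F | gamma in tau p a beta]
  = solutions p a beta.
Proof.
have vs := solutions_vector_space beta; have [_ _ vsZ] := vs.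
apply/seteqP; split=> [_ [s [c [_ Bs Sc ->]]]|x solx].
  apply: (vector_space_sum vs) => b bs; apply: vsZ; first exact: Sc.
  by have [gamma tg <-] := Bs _ bs; apply: Gseries_solution.
have [h [q [qp q0 xE]]] := frac_pth_repr charFp x.
have qF : q%:F != 0 :> K by rewrite tofrac_eq0.
have Sq : frac_pth 'F_p N p q%:F.
  exists q, 1; split=> //; [exact: ps_pth1|exact: oner_neq0|].
  by rewrite tofrac1 divr1.
(* The numerator is [x] times the constant [q], hence a solution that is a power series. *)
have solh : solutions p a beta h%:F.
  by rewrite -[h%:F](divfK qF) -xE mulrC; apply: vsZ.
have [t [c [tt cp hE]]] := series_solution_span solh.
have -> : x = \sum_(gamma <- t) (c gamma)%:F / q%:F * (Gseries gamma)%:F.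
  rewrite xE hE rmorph_sum mulr_suml; apply: eq_bigr => gamma _ /=.
  by rewrite tofracM mulrAC.
apply: span_over_sum => [|gamma _|gamma /tt tg]; first exact: frac_pth_vector_space.
  by exists (c gamma), q; split.
by exists gamma.
Qed.

End AHypergeometric.

Theorem theorem2p7 (p N n : nat) (hp : prime p)
    (a : 'I_N -> 'rV[int]_n) (beta : 'rV[int]_n) :
  is_vector_space_over (frac_pth 'F_p N p) (solutions p a beta) /\
  is_basis_over (frac_pth 'F_p N p) (solutions p a beta)
    [set FracField.tofrac (ps_of_mpoly (Gpoly p a gamma))
       | gamma in tau p a beta].
Proof.
split; first exact: solutions_vector_space.
by split; [exact: Gseries_lin_indep|exact: solutions_span].
Qed.
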